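(* Let $\phi:\mathbb{P}^2 \dashrightarrow \mathbb{P}^3$ be a rational map as in the context, with image surface $S$, and suppose there exists an inversion matrix $\mathbb{M}$ of $\phi$ (with associated integer $m$, monomial set $V=\{\mathbf{t}^{\alpha_1},\dots,\mathbf{t}^{\alpha_d}\}$ and monomials $\mathbf{t}^{\beta_1},\mathbf{t}^{\beta_2},\mathbf{t}^{\beta_3}\in V$ with $t_1\mathbf{t}^{\beta_3}=t_3\mathbf{t}^{\beta_1}$ and $t_2\mathbf{t}^{\beta_3}=t_3\mathbf{t}^{\beta_2}$). Then $\phi$, co-restricted to $S$, is birational (i.e. $\deg(\phi)=1$). Moreover, the rational map $$S\subset\mathbb{P}^3 \dashrightarrow \mathbb{P}^2,\qquad \underline{X}\mapsto \big(\Delta_{\beta_1}(\underline{X}):\Delta_{\beta_2}(\underline{X}):\Delta_{\beta_3}(\underline{X})\big)$$ is an inverse of $\phi$, where $\Delta_{\alpha}$ denotes the signed maximal minor of $\mathbb{M}$ obtained by erasing the row indexed by $\mathbf{t}^{\alpha}$.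
   Context: $\mathbb{K}$ is a field of characteristic zero. $\phi:\mathbb{P}^2\dashrightarrow\mathbb{P}^3$, $\mathbf{t}=(t_1:t_2:t_3)\mapsto (p_1(\mathbf{t}):p_2(\mathbf{t}):p_3(\mathbf{t}):p_4(\mathbf{t}))$, where $p_1,\dots,p_4\in\mathbb{K}[t_1,t_2,t_3]$ are homogeneous of the same degree, and $\phi$ is generically finite, so the closure of its image is an irreducible surface $S\subset\mathbb{P}^3$. Let $F\in\mathbb{K}[X_1,X_2,X_3,X_4]$ be the implicit equation of $S$ (the irreducible homogeneous polynomial of minimal degree with $F(p_1,\dots,p_4)\equiv 0$, defined up to a nonzero constant). $\mathbb{K}(S)$ denotes the field of rational functions of $S$ (rank over $\mathbb{K}(S)$ of a matrix with entries in $\mathbb{K}[\underline{X}]$ means rank of its image over the fraction field of $\mathbb{K}[\underline{X}]/(F)$), and $\mathbb{K}(\mathbb{P}^2)$ that of $\mathbb{P}^2$. $\phi$ induces an injective field morphism $\phi^\sharp:\mathbb{K}(S)\to\mathbb{K}(\mathbb{P}^2)$, $f\mapsto f\circ\phi$; $\deg(\phi):=[\mathbb{K}(\mathbb{P}^2):\mathbb{K}(S)]$, and $\phi$ is birational iff $\deg(\phi)=1$. A moving surface of bi-degree $(m;n)$ ($m,n\ge1$) is a polynomial $M(\mathbf{t};\underline{X})=\sum_{|\alpha|=n}A_\alpha(\mathbf{t})\underline{X}^\alpha$, bihomogeneous of degree $m$ in $\mathbf{t}=(t_1,t_2,t_3)$ and $n$ in $\underline{X}=(X_1,\dots,X_4)$.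 It follows $\phi$ if $M(\mathbf{t};p_1(\mathbf{t}),\dots,p_4(\mathbf{t}))=0$ identically. An inversion matrix of $\phi$ is a $d\times(d-1)$ matrix $\mathbb{M}$ with entries in $\mathbb{K}[\underline{X}]$ such that: (i) there exist an integer $m\ge1$ and distinct monomials $\mathbf{t}^{\alpha_1},\dots,\mathbf{t}^{\alpha_d}$ of degree $m$ in $\mathbf{t}$ (rows of $\mathbb{M}$ indexed by them) with ${}^t\mathbb{M}\,(\mathbf{t}^{\alpha_1},\dots,\mathbf{t}^{\alpha_d})^t=(M_1(\mathbf{t};\underline{X}),\dots,M_{d-1}(\mathbf{t};\underline{X}))^t$, each $M_i$ a moving surface of bi-degree $(m;d_i)$ following $\phi$, and there exist $\mathbf{t}^{\beta_1},\mathbf{t}^{\beta_2},\mathbf{t}^{\beta_3}$ among the $\mathbf{t}^{\alpha_i}$ with $t_1\mathbf{t}^{\beta_3}=t_3\mathbf{t}^{\beta_1}$ and $t_2\mathbf{t}^{\beta_3}=t_3\mathbf{t}^{\beta_2}$; (ii) the rank of $\mathbb{M}$ over $\mathbb{K}(S)$ is exactly $d-1$. Signed minors: $\Delta_{\alpha_i}=(-1)^{i}\det(\mathbb{M}_{\hat i})$, where $\mathbb{M}_{\hat i}$ is $\mathbb{M}$ with the row indexed by $\mathbf{t}^{\alpha_i}$ deleted (alternating signs, so that $(\Delta_{\alpha_1},\dots,\Delta_{\alpha_d})$ lies in the kernel of ${}^t\mathbb{M}$). *)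

(* Defs.v *)
From HB Require Import structures.
From mathcomp Require Import all_boot all_order all_algebra.
From mathcomp Require Import mpoly.

Set Implicit Arguments.
Unset Strict Implicit.
Unset Printing Implicit Defensive.

Import Order.TTheory GRing.Theory.
Local Open Scope ring_scope.

Section Defs.
Variable K : fieldType.

Definition tvar (i : 'I_3) : {mpoly K[3]} := 'X_i.
Definition t1 : {mpoly K[3]} := tvar (@Ordinal 3 0 isT).
Definition t2 : {mpoly K[3]} := tvar (@Ordinal 3 1 isT).
Definition t3 : {mpoly K[3]} := tvar (@Ordinal 3 2 isT).

Definition mdvd (F G : {mpoly K[4]}) : Prop := exists Q, G = Q * F.

Definition mirreducible (F : {mpoly K[4]}) : Prop :=
  (1 < msize F)%N /\
  forall A B : {mpoly K[4]}, F = A * B -> (msize A <= 1)%N \/ (msize B <= 1)%N.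

(* phi is generically finite, i.e. the closure of its image is a surface:
   the cone K[p1,..,p4] has transcendence degree 3, i.e. three of the p_i
   are algebraically independent over K. *)
Definition generically_finite (p : 4.-tuple {mpoly K[3]}) : Prop :=
  exists i j k : 'I_4, [/\ i != j, j != k & i != k] /\
    forall G : {mpoly K[3]}, G \mPo [tuple tnth p i; tnth p j; tnth p k] = 0 ->
      G = 0.

Definition implicit_equation (p : 4.-tuple {mpoly K[3]}) (F : {mpoly K[4]}) :
  Prop :=
  exists k : nat,
    [/\ F \is k.-homog, mirreducible F, F \mPo p = 0 &
        forall (G : {mpoly K[4]}) (k' : nat), G != 0 -> G \is k'.-homog ->
          G \mPo p = 0 -> (k <= k')%N].

(* Signed maximal minor Delta_{alpha_i} of a (n+1) x n matrix: delete the row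
   i (0-based, i.e. row i+1 in the paper's 1-based numbering) and multiply
   by (-1)^(i+1). *)
Definition Delta (n : nat) (M : 'M[{mpoly K[4]}]_(n.+1, n)) (i : 'I_n.+1) :
  {mpoly K[4]} := (-1) ^+ i.+1 * \det (row' i M).

(* deg(phi) = 1: the extension phi^#(K(S)) ⊆ K(P^2) is trivial, i.e. every
   element A/B of K(P^2) (A, B homogeneous of the same degree, B <> 0) is
   phi^#(G/H) = G(p)/H(p) for some element G/H of K(S) (G, H homogeneous of
   the same degree, H not vanishing on S, i.e. H(p) <> 0). *)
Definition degree_one (p : 4.-tuple {mpoly K[3]}) : Prop :=
  forall (A B : {mpoly K[3]}) (k : nat), A \is k.-homog -> B \is k.-homog ->
    B != 0 ->
    exists (G H : {mpoly K[4]}) (k' : nat),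
      [/\ G \is k'.-homog, H \is k'.-homog, H \mPo p != 0 &
          A * (H \mPo p) = B * (G \mPo p)].

Definition rational_inverse (p : 4.-tuple {mpoly K[3]}) (F : {mpoly K[4]})
  (psi : 3.-tuple {mpoly K[4]}) : Prop :=
  [/\ (* psi is defined on S *)
      exists k : 'I_3, ~ mdvd F (tnth psi k),
      (* psi o phi is defined on P^2 ... *)
      exists k : 'I_3, tnth psi k \mPo p != 0,
      (* ... and equals the identity of P^2 *)
      forall k l : 'I_3,
        (tnth psi k \mPo p) * tvar l = (tnth psi l \mPo p) * tvar k,
      (* phi o psi is defined on S ... *)
      exists i : 'I_4, ~ mdvd F (tnth p i \mPo psi) &
      (* ... and equals the identity of S *)
      forall i j : 'I_4,
        mdvd F ((tnth p i \mPo psi) * 'X_j - (tnth p j \mPo psi) * 'X_i)].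

End Defs.
Arguments t1 {K}.
Arguments t2 {K}.
Arguments t3 {K}.

(* Main.v *)
Require Import Defs.
From HB Require Import structures.
From mathcomp Require Import all_boot all_order all_algebra.
From mathcomp Require Import perm mpoly.
From Stdlib Require Import Classical.

Set Implicit Arguments.
Unset Strict Implicit.
Unset Printing Implicit Defensive.

Import Order.TTheory GRing.Theory.
Local Open Scope ring_scope.

(* Substituting X = p(t) in M gives a (n+1) x n matrix N whose left kernel
   contains both the vector of monomials t^(alpha_j) and the vector of signed
   minors Delta_j(p). The implicit equation F generates the ideal of all
   polynomials vanishing at p, so the rank hypothesis says that N has rank n;
   its left kernel is then a line and the two vectors are proportional. The
   relations between the monomials beta_1, beta_2, beta_3 give that
   (Delta_beta1(p) : Delta_beta2(p) : Delta_beta3(p)) = (t_1 : t_2 : t_3).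
   A homogeneous left inverse psi of phi determines everything else: by
   homogeneity A/B = (A(psi)/B(psi))(p), and phi o psi is the identity of S
   because this may be tested after substituting p.
   That F generates the ideal rests on unique factorization in K[X_1..X_n],
   stated as: every nonzero element is a unit times a product of primes. *)

(** * Primes, irreducibles and factorial rings *)

Section Divisibility.
Variable R : idomainType.
Implicit Types a b c x y : R.

Definition rdvd x y : Prop := exists q, y = q * x.

Definition rirreducible x : Prop :=
  [/\ x != 0, x \isn't a GRing.unit &
      forall a b, x = a * b -> a \is a GRing.unit \/ b \is a GRing.unit].

Definition rprime x : Prop :=
  [/\ x != 0, x \isn't a GRing.unit &
      forall a b, rdvd x (a * b) -> rdvd x a \/ rdvd x b].

(** Prime rather than irreducible factors: uniqueness of the factorization is then built into its
    existence. *)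
Inductive prime_product : R -> Prop :=
  | prime_product_unit u : u \is a GRing.unit -> prime_product u
  | prime_product_mul x c :
      rprime x -> prime_product c -> prime_product (x * c).

Definition factorial_ring : Prop := forall c, c != 0 -> prime_product c.

Lemma rdvd_mulr x a b : rdvd x a -> rdvd x (a * b).
Proof. by case=> q ->; exists (q * b); rewrite mulrAC. Qed.

Lemma rdvd_mull x a b : rdvd x b -> rdvd x (a * b).
Proof. by case=> q ->; exists (a * q); rewrite mulrA. Qed.

Lemma rdvdD x a b : rdvd x a -> rdvd x b -> rdvd x (a + b).
Proof. by case=> q -> [r ->]; exists (q + r); rewrite mulrDl. Qed.

Lemma rdvd_unitl x u y : u \is a GRing.unit -> rdvd x y -> rdvd (x * u) y.
Proof.
move=> uU [q ->]; exists (q * u^-1).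
by rewrite mulrCA mulrA [x * _]mulrC -!mulrA [u^-1 * _]mulrCA mulVr // mulr1 mulrC.
Qed.

Lemma prime_productM a b :
  prime_product a -> prime_product b -> prime_product (a * b).
Proof.
elim=> [u uU|x c xP _ IH] bP; last by rewrite -mulrA; apply: prime_product_mul (IH bP).
case: bP => [v vU|x c xP cP].
  by apply: prime_product_unit; rewrite unitrM uU vU.
rewrite mulrCA; apply: prime_product_mul => //.
elim: cP => [v vU|y d yP _ IH]; last by rewrite mulrCA; apply: prime_product_mul.
by apply: prime_product_unit; rewrite unitrM uU vU.
Qed.

(** A nonunit product of primes has a prime factor [y]; irreducibility makes its cofactor a unit, so
    [x] is associated to [y]. *)
Lemma rirreducible_prime x : prime_product x -> rirreducible x -> rprime x.
Proof.
case=> [u uU|y c [y0 yU yP] _]; first by case=> _ /negP [].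
case=> yc0 ycU irr; split=> // a b [q abE].
have cU : c \is a GRing.unit by case: (irr _ _ erefl) => // yU'; rewrite yU' in yU.
have : rdvd y (a * b) by exists (q * c); rewrite abE mulrA mulrAC.
by case/yP=> dv; [left | right]; apply: rdvd_unitl.
Qed.

End Divisibility.

Section Isomorphism.
Variables (R S : idomainType) (f : {rmorphism R -> S}) (g : {rmorphism S -> R}).
Hypotheses (fK : cancel f g) (gK : cancel g f).

Lemma unit_iso x : (f x \is a GRing.unit) = (x \is a GRing.unit).
Proof.
apply/idP/idP=> [fxU|]; last exact: rmorph_unit.
by rewrite -[x]fK rmorph_unit.
Qed.

Lemma rirreducible_iso x : rirreducible x -> rirreducible (f x).
Proof.
case=> x0 xU irr; split; last 1 first.
- move=> a b fxE; rewrite -[a]gK -[b]gK !unit_iso; apply: irr.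
  by rewrite -rmorphM -fxE fK.
- by apply: contraNneq x0 => fx0; rewrite -[x]fK fx0 rmorph0.
- by rewrite unit_iso.
Qed.

Lemma rprime_iso x : rprime (f x) -> rprime x.
Proof.
case=> fx0 fxU fxP; split=> [|| a b [q abE]].
- by apply: contraNneq fx0 => ->; rewrite rmorph0.
- by rewrite -unit_iso.
have : rdvd (f x) (f a * f b) by exists (f q); rewrite -!rmorphM abE.
by case/fxP=> -[r rE]; [left | right];
  exists (g r); rewrite -[x]fK -rmorphM -rE fK.
Qed.

End Isomorphism.

(** * Gauss' lemma *)

Section Gauss.
Variable R : idomainType.
Implicit Types (a b c x : R) (F G H P Q : {poly R}).

Lemma unit_polyC c : (c%:P \is a GRing.unit) = (c \is a GRing.unit).
Proof.
rewrite poly_unitE size_polyC coefC eqxx.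
by have [->|] := eqVneq c 0; rewrite ?unitr0.
Qed.

Lemma rdvd_polyC x c : rdvd x%:P c%:P <-> rdvd x c.
Proof.
split=> [[Q cE]|[q ->]]; last by exists q%:P; rewrite polyCM.
by exists Q`_0; rewrite -coefMC -cE coefC.
Qed.

(** Induction on the sum of the sizes: [x] divides the product of the leading coefficients, hence
    one of them, and the leading term of that polynomial can be removed. *)
Lemma rprime_polyC x : rprime x -> rprime x%:P.
Proof.
case=> x0 xU xP; split; rewrite ?polyC_eq0 ?unit_polyC // => P Q.
have top H : H != 0 -> exists2 H' : {poly R}, (size H' < size H)%N &
    H = H' + (lead_coef H)%:P * 'X^((size H).-1).
  move=> H0; have sH : (0 < size H)%N by rewrite size_poly_gt0.
  exists (H - (lead_coef H)%:P * 'X^((size H).-1)); last by rewrite subrK.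
  rewrite -(prednK sH) ltnS; apply/leq_sizeP => j lej.
  rewrite coefB coefCM coefXn; move: lej; rewrite leq_eqVlt.
  case/orP=> [/eqP <-|ltj]; first by rewrite eqxx mulr1 subrr.
  rewrite gtn_eqF // mulr0 subr0 nth_default //.
  by rewrite -(prednK sH).
have [k] := ubnP (size P + size Q); elim: k P Q => // k IH P Q.
rewrite ltnS => leszk dvPQ.
have [->|P0] := eqVneq P 0; first by left; exists 0; rewrite mul0r.
have [->|Q0] := eqVneq Q 0; first by right; exists 0; rewrite mul0r.
have dvlc : rdvd x (lead_coef P * lead_coef Q).
  case: dvPQ => T PQE; exists (lead_coef T).
  by rewrite -lead_coefM PQE lead_coefM lead_coefC.
have dvN H H' : rdvd x%:P (H' + H) -> rdvd x%:P H -> rdvd x%:P H'.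
  move=> dvS [q qE]; rewrite -[H'](addrK H); apply: rdvdD => //.
  by rewrite qE; exists (- q); rewrite mulNr.
case: (xP _ _ dvlc) => /rdvd_polyC dvl.
  have [P' ltP' PE] := top P P0.
  have dvT := rdvd_mulr 'X^((size P).-1) dvl.
  have [] // : rdvd x%:P P' \/ rdvd x%:P Q.
    apply: IH; first by apply: leq_trans leszk; rewrite ltn_add2r.
    apply: (@dvN ((lead_coef P)%:P * 'X^((size P).-1) * Q)); last exact: rdvd_mulr.
    by rewrite -mulrDl -PE.
  - by move=> dvP'; left; rewrite PE; apply: rdvdD.
  - by right.
have [Q' ltQ' QE] := top Q Q0.
have dvT := rdvd_mulr 'X^((size Q).-1) dvl.
have [] // : rdvd x%:P P \/ rdvd x%:P Q'.
  apply: IH; first by apply: leq_trans leszk; rewrite ltn_add2l.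
  apply: (@dvN (P * ((lead_coef Q)%:P * 'X^((size Q).-1)))); last exact: rdvd_mull.
  by rewrite -mulrDr -QE.
- by left.
- by move=> dvQ'; right; rewrite QE; apply: rdvdD.
Qed.

(** Each prime factor of [c] stays prime among polynomials, so it divides [H] or [Q] and can be
    cancelled there; [a] and [b] collect what each of the two loses. *)
Lemma clear_constant c G H Q : prime_product c -> c%:P * G = H * Q ->
  exists (H' Q' : {poly R}) (a b : R),
    [/\ G = H' * Q', H = a%:P * H' & Q = b%:P * Q'].
Proof.
move=> cP; elim: cP G H Q => [u uU|x d xP _ IH] G H Q.
  move=> uG; exists H, (u^-1%:P * Q), 1, u; split; first last.
  - by rewrite mulrA -polyCM divrr // mul1r.
  - by rewrite mul1r.
  - by rewrite mulrCA -uG mulrA -polyCM mulVr // mul1r.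
rewrite polyCM -mulrA => xdG.
have [x0 _ xM] := rprime_polyC xP.
have : rdvd x%:P (H * Q) by rewrite -xdG; exists (d%:P * G); rewrite mulrC.
case/xM=> -[T TE].
  have /IH : d%:P * G = T * Q.
    by apply: (mulfI x0); rewrite xdG TE mulrCA mulrA.
  case=> H' [Q' [a [b [-> TE' ->]]]]; exists H', Q', (x * a), b; split=> //.
  by rewrite TE TE' polyCM mulrC mulrA.
have /IH : d%:P * G = H * T.
  by apply: (mulfI x0); rewrite xdG TE mulrA mulrC.
case=> H' [Q' [a [b [-> -> TE']]]]; exists H', Q', a, (x * b); split=> //.
by rewrite TE TE' polyCM mulrC mulrA.
Qed.

Hypothesis factR : factorial_ring R.

Lemma unit_size1 P : P \is a GRing.unit -> size P = 1%N.
Proof. by rewrite poly_unitE => /andP [/eqP]. Qed.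

Lemma rirreducible_dvd_scaled F G c : rirreducible F -> (1 < size F)%N ->
  c != 0 -> rdvd F (c%:P * G) -> rdvd F G.
Proof.
case=> F0 _ irr szF c0 [Q]; rewrite [Q * F]mulrC => cG.
(* Of the factors of [F = a%:P * H], only the constant can be a unit, since [F] has positive degree;
   so [H] is [F] up to a unit. *)
have [H [Q' [a [b [-> FE _]]]]] := clear_constant (factR c0) cG.
case: (irr _ _ FE) => [aU|HU]; last first.
  case/negP: F0; move: szF; rewrite FE mul_polyC.
  by rewrite ltnNge (leq_trans (size_scale_leq _ _)) // unit_size1.
exists (Q' * (a%:P)^-1).
by rewrite FE mulrA divrK // mulrC.
Qed.

Lemma minimal_size (I : {poly R} -> Prop) F : F != 0 -> I F ->
  exists H, [/\ H != 0, I H &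
    forall G, I G -> G != 0 -> (size H <= size G)%N].
Proof.
have [k] := ubnP (size F); elim: k F => // k IH F ltk F0 IF.
case: (classic (exists G, [/\ I G, G != 0 & (size G < size F)%N])) => [|noG].
  by case=> G [IG G0 ltG]; apply: (IH G) => //; apply: leq_trans ltG _.
exists F; split=> // G IG G0; rewrite leqNgt; apply/negP=> ltG.
by apply: noG; exists G.
Qed.

(* Over the fraction field of R the ideal I is generated by an element H of
   minimal degree, and F being irreducible it is H up to a constant unless H
   itself is constant. *)
Lemma rirreducible_ideal (I : {poly R} -> Prop) F :
    (forall G H, I G -> I H -> I (G + H)) -> (forall Q G, I G -> I (Q * G)) ->
    rirreducible F -> (1 < size F)%N -> I F ->
  (exists2 c, c != 0 & I c%:P) \/ (forall G, I G -> rdvd F G).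
Proof.
move=> ID IM irrF szF IF; have [F0 _ irr] := irrF.
have [H [H0 IH Hmin]] := minimal_size F0 IF.
have [szH|szH] := leqP (size H) 1.
  left; exists H`_0; last by rewrite -size1_polyC.
  by rewrite -polyC_eq0 -size1_polyC.
(* Pseudo-division by [H]: the remainder lies in [I] and is smaller than [H], hence zero. *)
have pdiv G : I G -> exists2 c, c != 0 & exists Q, c%:P * G = Q * H.
  move=> IG; exists (lead_coef H ^+ scalp G H).
    by rewrite expf_neq0 // lead_coef_eq0.
  exists (G %/ H); have := Pdiv.Idomain.divp_eq G H; rewrite -mul_polyC => GE.
  rewrite GE; suff -> : G %% H = 0 by rewrite addr0.
  apply: contraTeq isT => rem0.
  have /Hmin/(_ rem0) : I (G %% H).
    have -> : G %% H = (lead_coef H ^+ scalp G H)%:P * G + - (G %/ H) * H.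
      by rewrite GE mulNr addrAC subrr add0r.
    by apply: ID; apply: IM.
  by rewrite leqNgt ltn_modp H0.
right=> G IG.
(* Clearing [c] writes [F] as [Q' * H'] with [H = b%:P * H']. As [H] is not constant, [Q'] is a unit
   and [F] divides [H]. *)
have [c c0 [Q cF]] := pdiv F IF.
have [Q' [H' [a [b [FE QE HE]]]]] := clear_constant (factR c0) cF.
have Q'U : Q' \is a GRing.unit.
  case: (irr _ _ FE) => // H'U; move: szH.
  by rewrite ltnNge HE mul_polyC (leq_trans (size_scale_leq _ _)) // unit_size1.
have [d d0 [T dG]] := pdiv G IG.
apply: (rirreducible_dvd_scaled irrF szF d0).
by exists (T * b%:P * Q'^-1); rewrite dG HE FE -!mulrA mulKr.
Qed.

Lemma rirreducible_prime_poly F : rirreducible F -> rprime F.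
Proof.
move=> irrF; have [F0 FU irr] := irrF.
have [szF|szF] := leqP (size F) 1.
  have FE := size1_polyC szF; rewrite FE; apply: rprime_polyC.
  have a0 : F`_0 != 0 by rewrite -polyC_eq0 -FE.
  apply: rirreducible_prime; first exact: factR.
  split=> //; first by rewrite -unit_polyC -FE.
  by move=> a b abE; rewrite -!unit_polyC; apply: irr; rewrite -polyCM -abE.
split=> // G H [T GHE].
(* In the ideal generated by [F] and [G], a nonzero constant [c] gives [F] dividing [c%:P * H],
   hence [H]; otherwise [F] divides every element, in particular [G]. *)
pose I P := exists U V, P = U * F + V * G.
have := @rirreducible_ideal I F; case=> //.
- move=> _ _ [U [V ->]] [U' [V' ->]]; exists (U + U'), (V + V').
  by rewrite !mulrDl addrACA.
- move=> Q _ [U [V ->]]; exists (Q * U), (Q * V).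
  by rewrite mulrDr !mulrA.
- by exists 1, 0; rewrite mul1r mul0r addr0.
- case=> c c0 [U [V cE]]; right.
  apply: (rirreducible_dvd_scaled irrF szF c0).
  exists (U * H + V * T); rewrite cE !mulrDl -!mulrA -GHE.
  by rewrite [F * H]mulrC.
- by move=> dvd; left; apply: dvd; exists 0, 1; rewrite mul1r mul0r add0r.
Qed.

End Gauss.

(** * Unique factorization in multivariate polynomial rings *)

Lemma rmorph_mpoly_ext (R S : comNzRingType) n
    (f g : {rmorphism {mpoly R[n]} -> S}) :
  (forall c, f c%:MP = g c%:MP) -> (forall i, f 'X_i = g 'X_i) -> f =1 g.
Proof.
move=> fgC fgX q; rewrite (mpolyE q) !rmorph_sum; apply: eq_bigr => m _.
rewrite -mul_mpolyC !rmorphM fgC; congr (_ * _).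
rewrite mpolyXE_id !rmorph_prod; apply: eq_bigr => i _.
by rewrite !rmorphXn fgX.
Qed.

Lemma rmorph_poly_ext (R S : comNzRingType) (f g : {rmorphism {poly R} -> S}) :
  (forall c, f c%:P = g c%:P) -> f 'X = g 'X -> f =1 g.
Proof.
move=> fgC fgX; elim/poly_ind=> [|q c IH]; first by rewrite !rmorph0.
by rewrite !rmorphD !rmorphM IH fgX fgC.
Qed.

(* The variables other than 'X_l are renumbered through s, which need not be
   monotone: an arbitrary transcendence basis p_i, p_j, p_k has to be allowed. *)
Section MainVariable.
Variables (K : fieldType) (n : nat) (s : 'I_n -> 'I_n.+1) (l : 'I_n.+1).
Hypotheses (s_inj : injective s) (l_notin : forall j, s j != l).

Definition poly_in : {mpoly K[n.+1]} -> {poly {mpoly K[n]}} :=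
  mmap (polyC \o @mpolyC n K)
    (fun i => if [pick j | s j == i] is Some j then ('X_j)%:P else 'X).
HB.instance Definition _ := GRing.RMorphism.on poly_in.

Definition mpoly_out : {poly {mpoly K[n]}} -> {mpoly K[n.+1]} :=
  horner_eval 'X_l \o map_poly (comp_mpoly [tuple 'X_(s j) | j < n]).
HB.instance Definition _ := GRing.RMorphism.on mpoly_out.

Lemma mpoly_outC c : mpoly_out c%:P = c \mPo [tuple 'X_(s j) | j < n].
Proof. by rewrite /mpoly_out /= /horner_eval map_polyC hornerC. Qed.

Lemma mpoly_outX : mpoly_out 'X = 'X_l.
Proof. by rewrite /mpoly_out /= /horner_eval map_polyX hornerX. Qed.

Lemma poly_in_s j : poly_in 'X_(s j) = ('X_j)%:P.
Proof.
rewrite /poly_in mmapX mmap1U; case: pickP => [k /eqP /s_inj -> //|/(_ j)].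
by rewrite eqxx.
Qed.

Lemma poly_in_l : poly_in 'X_l = 'X.
Proof.
rewrite /poly_in mmapX mmap1U; case: pickP => [k /eqP skl|//].
by have := l_notin k; rewrite skl eqxx.
Qed.

Lemma poly_inC c : poly_in c%:MP = c%:MP%:P.
Proof. by rewrite /poly_in mmapC. Qed.

Lemma main_variable_cases i : i = l \/ exists j, i = s j.
Proof.
(* Extending [s] by [l] gives an injection between two sets of n + 1 elements, hence a
   surjection. *)
pose f o := if o is Some j then s j else l.
have f_inj : injective f.
  move=> [j|] [k|] //= => [/s_inj -> //|/eqP|/eqP].
  - by rewrite (negbTE (l_notin j)).
  - by rewrite eq_sym (negbTE (l_notin k)).
have /codomP [[j|] ->] : i \in codom f; last by left.
  by apply: inj_card_onto => //; rewrite card_option !card_ord.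
by right; exists j.
Qed.

Lemma poly_inK : cancel poly_in mpoly_out.
Proof.
apply: (@rmorph_mpoly_ext _ _ _ (mpoly_out \o poly_in) idfun) => [c|i] /=.
  by rewrite poly_inC mpoly_outC comp_mpolyC.
case: (main_variable_cases i) => [->|[j ->]].
  by rewrite poly_in_l mpoly_outX.
by rewrite poly_in_s mpoly_outC comp_mpolyXU -tnth_nth tnth_mktuple.
Qed.

Lemma mpoly_outK : cancel mpoly_out poly_in.
Proof.
apply: (@rmorph_poly_ext _ _ (poly_in \o mpoly_out) idfun) => [c|] /=; last first.
  by rewrite mpoly_outX poly_in_l.
rewrite mpoly_outC; move: c.
apply: (@rmorph_mpoly_ext _ _ _
  (poly_in \o comp_mpoly [tuple 'X_(s j) | j < n]) polyC) => [c|i] /=.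
  by rewrite comp_mpolyC poly_inC.
by rewrite comp_mpolyXU -tnth_nth tnth_mktuple poly_in_s.
Qed.

End MainVariable.

Lemma unit_msize (K : fieldType) n (a : {mpoly K[n]}) :
  a != 0 -> (a \is a GRing.unit) = (msize a <= 1)%N.
Proof.
move=> a0; apply/idP/idP=> [aU|/msize1_polyC aE].
  have := congr1 (fun q => msize q) (divrr aU).
  rewrite msizeM ?invr_eq0 // msize1 => /eqP.
  have : (0 < msize a^-1)%N by rewrite lt0n msize_poly_eq0 invr_eq0.
  by case: (msize a^-1) => // k _; rewrite addnS /= => /eqP <-; rewrite leq_addr.
by rewrite aE rmorph_unit // unitfE -(mpolyC_eq0 n) -aE.
Qed.

(** Induction on the number of variables, then on the degree. An irreducible element is prime by
    Gauss' lemma in one main variable; a reducible one splits into factors of smaller degree. *)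
Lemma mpoly_factorial (K : fieldType) n : factorial_ring {mpoly K[n]}.
Proof.
elim: n => [|n IHn] a a0.
  apply: prime_product_unit; rewrite unit_msize //.
  rewrite msizeE; apply/bigmax_leqP_seq => m _ _.
  by rewrite ltnS leqn0 mdegE big_ord0.
have l_notin j : lift ord0 j != ord0 :> 'I_n.+1 by [].
have fK := @poly_inK K n _ ord0 lift_inj l_notin.
have gK := @mpoly_outK K n _ ord0 lift_inj l_notin.
have [k] := ubnP (msize a); elim: k a a0 => // k IHk a a0 ltak.
have [aU|aU] := boolP (a \is a GRing.unit); first exact: prime_product_unit.
case: (classic (rirreducible a)) => [irr|red].
  rewrite -[a]mulr1; apply: prime_product_mul; last first.
    by apply: prime_product_unit; rewrite unitr1.
  apply: (rprime_iso fK); apply: rirreducible_prime_poly => //.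
  exact: (rirreducible_iso fK gK irr).
have [b [c [abc bU cU]]] : exists b c, [/\ a = b * c,
    b \isn't a GRing.unit & c \isn't a GRing.unit].
  apply: NNPP => no; apply: red; split=> // b c abc.
  have [|bU] := boolP (b \is a GRing.unit); first by left.
  have [|cU] := boolP (c \is a GRing.unit); first by right.
  by case: no; exists b, c.
move: a0 ltak; rewrite abc mulf_eq0 negb_or => /andP [b0 c0].
rewrite msizeM // => lt.
move: bU cU; rewrite !unit_msize // -!ltnNge => bU cU.
(* Nonunits have [msize] at least 2, and [msize] is the degree plus one, so both factors drop in
   degree. *)
have [ltb ltc] : (msize b < k /\ msize c < k)%N.
  move: lt bU cU; case: (msize b) (msize c) => [|x] [|[|y]] //=.
  rewrite addnS /= ltnS => lt x0 _; split.
    by apply: leq_trans lt; rewrite addnS !ltnS leq_addr.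
  by apply: leq_trans lt; rewrite ?addSn ?addnS !ltnS -{1}[y]add0n ltn_add2r.
by apply: prime_productM; apply: IHk.
Qed.

(** * The ideal of the image surface *)

Section ImplicitEquation.
Variables (K : fieldType) (p : 4.-tuple {mpoly K[3]}) (F : {mpoly K[4]}).
Hypotheses (pfin : generically_finite p) (pF : implicit_equation p F).

Lemma mdvd_comp0 G : mdvd F G -> G \mPo p = 0.
Proof.
by case: pF => _ [_ _ Fp _] [Q ->]; rewrite rmorphM /= Fp mulr0.
Qed.

Lemma comp0_mdvd G : G \mPo p = 0 -> mdvd F G.
Proof.
move=> Gp; have [_ [_ [szF Firr] Fp _]] := pF.
case: pfin => i [j [k [[ij jk ik] indep]]].
pose s := tnth [tuple i; j; k].
have s_inj : injective s.
  by apply/tuple_uniqP; rewrite /= !inE negb_or ij ik jk.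
have [l l_notin] : exists l, forall h, s h != l.
  have : (#|[set i; j; k]| < #|'I_4|)%N.
    by rewrite card_ord (leq_ltn_trans (leq_card_setU _ _)) // cards2 cards1 ij.
  rewrite ltnNge => /negP lt.
  have [l lN] : exists l, l \notin [set i; j; k].
    apply/existsP; apply: contra_notT lt; rewrite negb_exists => /forallP all.
    apply/subset_leq_card/subsetP=> x _; move: (all x); by rewrite negbK.
  exists l => h; apply: contraNneq lN => <-; rewrite !inE.
  have := mem_tnth h [tuple i; j; k]; rewrite !inE.
  by rewrite orbA.
have fK := @poly_inK K 3 s l s_inj l_notin.
have gK := @mpoly_outK K 3 s l s_inj l_notin.
set f := poly_in _ in fK gK; set g := mpoly_out _ _ in fK gK.
have F0 : F != 0 by apply: contraTneq szF => ->; rewrite msize0.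
have irrF : rirreducible F.
  split=> //; first by rewrite unit_msize // -ltnNge.
  move=> A B FE; move: F0; rewrite FE mulf_eq0 negb_or => /andP [A0 B0].
  by rewrite !unit_msize //; apply: Firr.
pose I P := g P \mPo p = 0.
(* A constant here is a polynomial in the three algebraically independent coordinates, which
   excludes the first alternative of [rirreducible_ideal]. *)
have noconst c : I c%:P -> c = 0.
  rewrite /I /g mpoly_outC => cp; apply: indep; rewrite -cp.
  pose q := [tuple 'X_(s j) | j < 3] : 3.-tuple {mpoly K[4]}.
  apply: (@rmorph_mpoly_ext _ _ _
    (comp_mpoly _) (comp_mpoly p \o comp_mpoly q)) => [a|h] /=.
    by rewrite !comp_mpolyC.
  rewrite !comp_mpolyXU -!tnth_nth tnth_mktuple comp_mpolyXU -tnth_nth /s.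
  by case: h => [[|[|[|]]] h] //=; rewrite !(tnth_nth 0) /= (tnth_nth i).
have szfF : (1 < size (f F))%N.
  rewrite ltnNge; apply/negP=> /size1_polyC fFE.
  have : I (f F) by rewrite /I fK.
  rewrite fFE => /noconst c0.
  by case/negP: F0; rewrite -[F]fK fFE c0 /g !rmorph0.
have [] := rirreducible_ideal (@mpoly_factorial K 3) (I := I) _ _
  (rirreducible_iso fK gK irrF) szfF.
- by move=> A B IA IB; rewrite /I /g !rmorphD /= IA IB addr0.
- by move=> Q A IA; rewrite /I /g !rmorphM /= IA mulr0.
- by rewrite /I fK.
- by case=> c c0 /noconst cE; rewrite cE eqxx in c0.
case/(_ (f G)); first by rewrite /I fK.
move=> Q GE; exists (g Q); rewrite -[G]fK GE -[F in RHS]fK; exact: rmorphM.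
Qed.

End ImplicitEquation.

(** * The inverse given by the signed minors *)

Lemma signed_minors_ker (R : comNzRingType) n (N : 'M[R]_(n.+1, n)) k :
  \sum_(j < n.+1) (-1) ^+ j.+1 * \det (row' j N) * N j k = 0.
Proof.
(* [A] is [N] with its column [k] repeated in front; its vanishing determinant is expanded along
   that new column. *)
pose A := \matrix_(i, j) N i (odflt k (unlift ord0 j)).
have detA0 : \det A = 0.
  rewrite -det_tr; apply: (determinant_alternate (neq_lift ord0 k)) => i.
  by rewrite !mxE unlift_none liftK.
have colA : col' ord0 A = N by apply/matrixP=> i j; rewrite !mxE liftK.
transitivity (- \det A); last by rewrite detA0 oppr0.
rewrite (expand_det_col A ord0) -sumrN.
apply: eq_bigr => j _; rewrite /cofactor colA mxE unlift_none addn0 /=.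
by rewrite mulrC exprS mulN1r mulNr mulrN.
Qed.

(** The combination [w] of [u] and [v] that cancels entry [i] is still in the kernel, so its other
    entries are killed by [row' i N]; multiplying by the adjugate shows that they vanish. *)
Lemma ker_proportional (R : idomainType) n (N : 'M[R]_(n.+1, n))
    (u v : 'I_n.+1 -> R) i j :
    (forall k, \sum_h u h * N h k = 0) -> (forall k, \sum_h v h * N h k = 0) ->
  \det (row' i N) != 0 -> u i * v j = v i * u j.
Proof.
move=> uN vN det0; pose w h := u i * v h - v i * u h.
have wi : w i = 0 by rewrite /w mulrC subrr.
have wN k : \sum_h w h * N h k = 0.
  under eq_bigr do rewrite mulrBl -!mulrA.
  by rewrite sumrB -!mulr_sumr uN vN !mulr0 subrr.
pose w' := \row_h w (lift i h).
have w'N : w' *m row' i N = 0.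
  apply/rowP=> k; rewrite !mxE -[RHS](wN k) (bigD1_ord i) //= wi mul0r add0r.
  by apply: eq_bigr => h _; rewrite !mxE.
have w0 h : w (lift i h) = 0.
  have /matrixP/(_ 0 h) := congr1 (mulmx^~ (\adj (row' i N))) w'N.
  rewrite /= mul0mx -mulmxA mul_mx_adj mul_mx_scalar !mxE => /eqP.
  by rewrite mulf_eq0 (negbTE det0) => /eqP.
apply/eqP; rewrite -subr_eq0 -/(w j).
by have [h ->|->] := unliftP i j; rewrite ?w0 ?wi.
Qed.

(** All ratios of entries of [dl] agree with those of [tau], and the two monomial relations make the
    ratios at [b1], [b2], [b3] those of [x1], [x2], [x3]. *)
Lemma proportional_coordinates (R : idomainType) (I : Type) (tau dl : I -> R)
    (i b1 b2 b3 : I) (x1 x2 x3 : R) :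
    (forall j, tau j != 0) -> dl i != 0 ->
    (forall j, tau i * dl j = dl i * tau j) -> x3 != 0 ->
    x1 * tau b3 = x3 * tau b1 -> x2 * tau b3 = x3 * tau b2 ->
  [/\ dl b3 != 0, dl b1 * x2 = dl b2 * x1, dl b1 * x3 = dl b3 * x1 &
      dl b2 * x3 = dl b3 * x2].
Proof.
move=> tau0 dli prop x30 hb1 hb2.
have dl_tau j k : dl j * tau k = dl k * tau j.
  by apply: (mulfI (tau0 i)); rewrite !mulrA !prop mulrAC.
have d13 : dl b1 * x3 = dl b3 * x1.
  apply: (mulIf (tau0 b1)).
  by rewrite -mulrA -hb1 mulrCA dl_tau mulrCA mulrA.
have d23 : dl b2 * x3 = dl b3 * x2.
  apply: (mulIf (tau0 b2)).
  by rewrite -mulrA -hb2 mulrCA dl_tau mulrCA mulrA.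
split=> //; last by apply: (mulIf x30); rewrite mulrAC d13 [RHS]mulrAC d23 mulrAC.
have : tau i * dl b3 != 0 by rewrite prop mulf_neq0.
by rewrite mulf_eq0 negb_or => /andP [].
Qed.

Lemma ord3_proportional (R : comNzRingType) (u v : 'I_3 -> R)
    (o1 := @Ordinal 3 0 isT) (o2 := @Ordinal 3 1 isT) (o3 := @Ordinal 3 2 isT) :
    u o1 * v o2 = u o2 * v o1 -> u o1 * v o3 = u o3 * v o1 ->
    u o2 * v o3 = u o3 * v o2 ->
  forall k l, u k * v l = u l * v k.
Proof.
move=> uv12 uv13 uv23.
have cases (i : 'I_3) : [\/ i = o1, i = o2 | i = o3].
  case: i => [[|[|[|//]]] h]; [apply: Or31 | apply: Or32 | apply: Or33];
    exact: val_inj.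
by move=> k l; case: (cases k) => ->; case: (cases l) => ->.
Qed.

(** * Homogeneity of determinants and compositions *)

Section Homogeneous.
Variables (K : fieldType) (n : nat).

Lemma dhomog_bigprod k (q : 'I_k -> {mpoly K[n]}) (d : 'I_k -> nat) :
  (forall i, q i \is (d i).-homog) ->
  \prod_i q i \is (\sum_i d i).-homog.
Proof.
move=> qd; apply: (big_ind2 (fun (a : {mpoly K[n]}) b => a \is b.-homog)) => //.
- exact: dhomog1.
- by move=> a b c e ab ce; apply: dhomogM.
Qed.

Lemma dhomog_det k (A : 'M[{mpoly K[n]}]_k) (d : 'I_k -> nat) :
  (forall i j, A i j \is (d j).-homog) -> \det A \is (\sum_j d j).-homog.
Proof.
move=> Ad; apply: rpred_sum => s _.
suff h : \prod_i A i (s i) \is (\sum_j d j).-homog.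
  by case: (odd_perm s); rewrite ?mulN1r ?mul1r ?rpredN.
(* Each permutation takes one entry from every column, so all terms have the same degree. *)
by rewrite [X in X.-homog](reindex_inj (@perm_inj _ s)) /=; apply: dhomog_bigprod.
Qed.

Lemma dhomog_comp k (q : {mpoly K[k]}) (lq : k.-tuple {mpoly K[n]}) d e :
  q \is d.-homog -> (forall i, tnth lq i \is e.-homog) ->
  q \mPo lq \is (e * d).-homog.
Proof.
move=> qd lqe; rewrite comp_mpolyEX big_seq; apply: rpred_sum => m mq.
apply: rpredZ; have /= <- := dhomog_mf qd mq.
rewrite comp_mpolyX mdegE big_distrr /=.
by apply: dhomog_bigprod => i; apply: dhomogMn.
Qed.

Lemma comp_dhomogZ k (q : {mpoly K[k]}) (lq : k.-tuple {mpoly K[n]}) d a :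
  q \is d.-homog ->
  q \mPo [tuple a * tnth lq i | i < k] = a ^+ d * (q \mPo lq).
Proof.
move=> qd; rewrite !comp_mpolyEX big_seq [in RHS]big_seq mulr_sumr.
apply: eq_bigr => m mq; rewrite -scalerAr; congr (_ *: _).
have /= <- := dhomog_mf qd mq; rewrite !comp_mpolyX mdegE expr_sum -big_split /=.
by apply: eq_bigr => i _; rewrite tnth_mktuple exprMn.
Qed.

End Homogeneous.

Lemma comp_mpolyA (K : fieldType) n k h (q : {mpoly K[n]})
    (lp : n.-tuple {mpoly K[k]}) (lq : k.-tuple {mpoly K[h]}) :
  (q \mPo lp) \mPo lq = q \mPo [tuple tnth lp i \mPo lq | i < n].
Proof.
apply: (@rmorph_mpoly_ext _ _ _ (comp_mpoly lq \o comp_mpoly lp)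
  (comp_mpoly [tuple tnth lp i \mPo lq | i < n])) => [c|i] /=.
  by rewrite !comp_mpolyC.
by rewrite !comp_mpolyXU -!tnth_nth tnth_mktuple.
Qed.

(** By homogeneity the two sides are the values of [q] at the tuples with entries
    [tvar K l * tnth del k] and [tnth del l * tvar K k], which coincide. *)
Lemma comp_proportional (K : fieldType) (del : 3.-tuple {mpoly K[3]}) d q :
  (forall k l, tnth del k * tvar K l = tnth del l * tvar K k) ->
  q \is d.-homog -> forall l, tvar K l ^+ d * (q \mPo del) = tnth del l ^+ d * q.
Proof.
move=> prop qd l; rewrite -(comp_dhomogZ _ _ qd).
rewrite -{2}[q]comp_mpoly_id -(comp_dhomogZ _ _ qd); congr (_ \mPo _).
by apply: eq_from_tnth => k; rewrite !tnth_mktuple mulrC prop.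
Qed.

Lemma mpolyX_neq0 (K : fieldType) n (m : 'X_{1..n}) :
  'X_[m] != 0 :> {mpoly K[n]}.
Proof. by rewrite -msize_poly_eq0 msizeX. Qed.

(** * Birationality from a homogeneous left inverse *)

Section LeftInverse.
Variables (K : fieldType) (p : 4.-tuple {mpoly K[3]}) (e : nat).
Hypotheses (p_homog : forall i : 'I_4, tnth p i \is e.-homog)
  (pfin : generically_finite p).
Variables (F : {mpoly K[4]}) (psi : 3.-tuple {mpoly K[4]}) (D : nat).
Hypothesis F_impl : implicit_equation p F.
Hypothesis psi_homog : forall k, tnth psi k \is D.-homog.
Hypothesis psi_p : exists k, tnth psi k \mPo p != 0.
Hypothesis psi_inv : forall k l,
  (tnth psi k \mPo p) * tvar K l = (tnth psi l \mPo p) * tvar K k.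

Let del := [tuple tnth psi k \mPo p | k < 3].

Let del_prop k l : tnth del k * tvar K l = tnth del l * tvar K k.
Proof. by rewrite !tnth_mktuple. Qed.

Let tvar_neq0 l : tvar K l != 0.
Proof. exact: mpolyX_neq0. Qed.

(** Substituting [del] multiplies every form of degree [d] by one common factor, the [d]-th power of
    the ratio of [del] to the variables. *)
Lemma comp_left_inverse q q' d : q \is d.-homog -> q' \is d.-homog ->
  q * ((q' \mPo psi) \mPo p) = q' * ((q \mPo psi) \mPo p).
Proof.
move=> qd q'd; rewrite !comp_mpolyA -/del.
apply: (mulfI (expf_neq0 d (tvar_neq0 0))).
rewrite mulrCA [RHS]mulrCA !(comp_proportional del_prop) //.
by rewrite mulrCA [q' * _]mulrCA [q' * _]mulrC.
Qed.

Lemma comp_left_inverse_neq0 q d : q \is d.-homog -> q != 0 ->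
  (q \mPo psi) \mPo p != 0.
Proof.
move=> qd q0; rewrite comp_mpolyA -/del; have [l del0] := psi_p.
apply: contraTneq isT => qdel0.
have := comp_proportional del_prop qd l; rewrite qdel0 mulr0 => /esym/eqP.
by rewrite mulf_eq0 (negbTE q0) expf_eq0 tnth_mktuple (negbTE del0) andbF.
Qed.

Lemma left_inverse_degree_one : degree_one p.
Proof.
move=> A B k Ak Bk B0; exists (A \mPo psi), (B \mPo psi), (D * k)%N; split.
- exact: dhomog_comp.
- exact: dhomog_comp.
- exact: comp_left_inverse_neq0 Bk B0.
- exact: comp_left_inverse Ak Bk.
Qed.

Lemma left_inverse_rational_inverse : rational_inverse p F psi.
Proof.
split=> //.
- by have [k del0] := psi_p; exists k => /(mdvd_comp0 F_impl)/eqP; apply/negP.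
- have [i [j [k [_ indep]]]] := pfin; exists i => /(mdvd_comp0 F_impl)/eqP.
  apply/negP; apply: comp_left_inverse_neq0 (p_homog i) _.
  (* If [tnth p i] were zero, the first variable would be a nonzero relation between the three
     independent coordinates. *)
  apply: contraTneq isT => pi0.
  have /eqP := tvar_neq0 0; case; apply: indep.
  by rewrite comp_mpolyXU /= pi0.
- move=> i j; apply: (comp0_mdvd pfin F_impl); rewrite rmorphB !rmorphM /=.
  rewrite !comp_mpolyXU -!tnth_nth mulrC.
  by rewrite (comp_left_inverse (p_homog j) (p_homog i)) mulrC subrr.
Qed.

End LeftInverse.

(* The inversion matrix has d = n.+1 rows (indexed by the monomials
   t^(alpha j)) and d - 1 = n columns; column i is the moving surface M_{i+1}
   of bi-degree (m; dX i). *)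
Theorem theorem3p2
  (K : fieldType) (charK0 : [pchar K] =i pred0)
  (p : 4.-tuple {mpoly K[3]}) (e : nat)
  (p_homog : forall i : 'I_4, tnth p i \is e.-homog)
  (phi_gen_finite : generically_finite p)
  (F : {mpoly K[4]}) (F_impl : implicit_equation p F)
  (n : nat) (M : 'M[{mpoly K[4]}]_(n.+1, n))
  (m : nat) (m_gt0 : (0 < m)%N)
  (alpha : 'I_n.+1 -> 'X_{1..3})
  (alpha_inj : injective alpha)
  (alpha_deg : forall j, mdeg (alpha j) = m)
  (dX : 'I_n -> nat) (dX_gt0 : forall i, (0 < dX i)%N)
  (M_homog : forall (j : 'I_n.+1) (i : 'I_n), M j i \is (dX i).-homog)
  (M_follows : forall i : 'I_n,
     \sum_(j < n.+1) ('X_[alpha j] : {mpoly K[3]}) * (M j i \mPo p) = 0)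
  (b1 b2 b3 : 'I_n.+1)
  (hb1 : (t1 : {mpoly K[3]}) * 'X_[alpha b3] = t3 * 'X_[alpha b1])
  (hb2 : (t2 : {mpoly K[3]}) * 'X_[alpha b3] = t3 * 'X_[alpha b2])
  (M_rank : exists i : 'I_n.+1, ~ mdvd F (\det (row' i M))) :
  degree_one p /\
  rational_inverse p F [tuple Delta M b1; Delta M b2; Delta M b3].
Proof.
pose N := map_mx (comp_mpoly p) M.
pose dl j := Delta M j \mPo p.
pose tau j : {mpoly K[3]} := 'X_[alpha j].
have dlE j : dl j = (-1) ^+ j.+1 * \det (row' j N).
  by rewrite /dl /Delta rmorphM rmorphXn rmorphN1 /= -map_row' det_map_mx.
have dlN k : \sum_j dl j * N j k = 0.
  by rewrite -[RHS](signed_minors_ker N k); apply: eq_bigr => j _; rewrite dlE.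
have tauN k : \sum_j tau j * N j k = 0.
  by rewrite -[RHS](M_follows k); apply: eq_bigr => j _; rewrite mxE.
have [i rki] := M_rank.
have deti : \det (row' i N) != 0.
  rewrite -map_row' det_map_mx; apply/eqP => det0; apply: rki.
  exact: (comp0_mdvd phi_gen_finite F_impl).
have dli : dl i != 0 by rewrite dlE mulf_neq0 // signr_eq0.
have tau0 j : tau j != 0 by exact: mpolyX_neq0.
have prop j : tau i * dl j = dl i * tau j := ker_proportional j tauN dlN deti.
have t30 : t3 != 0 :> {mpoly K[3]} by exact: mpolyX_neq0.
have [dlb3 d12 d13 d23] :=
  proportional_coordinates tau0 dli prop t30 hb1 hb2.
pose psi := [tuple Delta M b1; Delta M b2; Delta M b3].
(* Erasing a row leaves the column degrees unchanged, so the three minors share one degree. *)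
have psi_homog k : tnth psi k \is (\sum_j dX j).-homog.
  have hom b : Delta M b \is (\sum_j dX j).-homog.
    have h : \det (row' b M) \is (\sum_j dX j).-homog.
      by apply: dhomog_det => h j; rewrite mxE.
    by rewrite /Delta -signr_odd; case: odd; rewrite ?mulN1r ?mul1r ?rpredN.
  by case: k => [[|[|[|]]] h] //; rewrite (tnth_nth 0) /=.
have psi_p : exists k, tnth psi k \mPo p != 0.
  (* The third coordinate is [dl b3], nonzero by [dlb3]. *)
  by exists (@Ordinal 3 2 isT).
have psi_inv k l :
    (tnth psi k \mPo p) * tvar K l = (tnth psi l \mPo p) * tvar K k.
  exact: (ord3_proportional (u := fun k => tnth psi k \mPo p) d12 d13 d23).
split; first exact: (left_inverse_degree_one psi_homog psi_p psi_inv).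
exact: left_inverse_rational_inverse.
Qed.
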